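(* For any finite matrix family $\mathcal{F}=\{A_1,A_2,\ldots,A_m\}\subset\mathbb{C}^{n\times n}$, there holds $$\rho(\mathcal{F})=\limsup_{k\to\infty}\rho(\mathsf{P}(\mathcal{F}_k))^{1/k}.$$
   Context: For a finite set $\mathcal{F}=\{A_1,\ldots,A_m\}$ of complex $n\times n$ matrices and $k\ge 1$, let $\mathcal{F}_k=\{A_{i_1}A_{i_2}\cdots A_{i_k}: 1\le i_j\le m\}$ be the set of all products of length $k$. The joint (equivalently, generalized) spectral radius of a finite set $\mathcal{F}$ is $\rho(\mathcal{F})=\lim_{k\to\infty}\max_{A\in\mathcal{F}_k}\|A\|^{1/k}=\limsup_{k\to\infty}\max_{A\in\mathcal{F}_k}\rho(A)^{1/k}$, where $\|\cdot\|$ is any sub-multiplicative matrix norm and $\rho(A)$ is the spectral radius of a matrix $A$ (the two expressions are known to coincide for finite sets). Rank-one approximation: for $A\in\mathbb{C}^{n\times n}$ take a singular value decomposition $A=\sum_{i=1}^n\sigma_iu_iv_i^*$, with $\sigma_1\ge\cdots\ge\sigma_n\ge0$ the singular values and $u_i$, $v_i$ the $i$-th left and right singular vectors ($\{u_i\}$ and $\{v_i\}$ orthonormal bases). Define $\mathsf{P}(A)=\sigma_{i'}u_{i'}v_{i'}^*$, where $i'$ is an index maximizing $|\mathrm{tr}(\sigma_iu_iv_i^* )|=\rho(\sigma_iu_iv_i^* )$ over $1\le i\le n$. (For each matrix $A$ an arbitrary choice of singular value decomposition and of maximizing index is fixed.) For a finite set $\mathcal{G}$ of matrices, $\mathsf{P}(\mathcal{G})=\{\mathsf{P}(A):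 A\in\mathcal{G}\}$; thus $\rho(\mathsf{P}(\mathcal{F}_k))$ is the joint spectral radius of the finite set $\mathsf{P}(\mathcal{F}_k)$. *)

(* Defs.v *)
From HB Require Import structures.
From mathcomp Require Import all_boot all_order all_algebra.
From mathcomp Require Import finmap complex.
From mathcomp Require Import all_classical all_reals all_analysis.

Set Implicit Arguments.
Unset Strict Implicit.
Unset Printing Implicit Defensive.

Import Order.TTheory GRing.Theory Num.Theory.
Import numFieldNormedType.Exports.

Local Open Scope fset_scope.
Local Open Scope complex_scope.
Local Open Scope sesquilinear_scope.
Local Open Scope ring_scope.

(* The homogeneity axiom is an equation in R[i], where the modulus lives. *)
Record submult_mxnorm (R : realType) (n : nat) (N : 'M[R[i]]_n -> R) : Prop :=
  SubmultMxnorm {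
    mxnorm_ge0 : forall A, 0 <= N A;
    mxnorm_eq0 : forall A, N A = 0 -> A = 0;
    mxnorm_triangle : forall A B, N (A + B) <= N A + N B;
    mxnorm_scale : forall (c : R[i]) A, (N (c *: A))%:C = `|c| * (N A)%:C;
    mxnorm_mul : forall A B, N (A *m B) <= N A * N B }.

Fixpoint prods (R : realType) (n : nat) (F : {fset 'M[R[i]]_n}) (k : nat)
    : {fset 'M[R[i]]_n} :=
  if k is k'.+1 then [fset A *m B | A in F, B in prods F k'] else [fset 1%:M].

(* Since N is nonnegative, the default value 0 of the maximum only matters for
   an empty set of matrices. For a submultiplicative norm the limit exists by
   Fekete's lemma; the index k = 0 is irrelevant to it. *)
Definition jsr (R : realType) (n : nat) (N : 'M[R[i]]_n -> R)
    (F : {fset 'M[R[i]]_n}) : R :=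
  limn (fun k : nat =>
    (\big[Num.max/0]_(A <- prods F k) N A) `^ (k%:R^-1)).

Definition svd_term (R : realType) (n : nat) (s : 'I_n -> R)
    (U V : 'M[R[i]]_n) (i : 'I_n) : 'M[R[i]]_n :=
  (s i)%:C *: (col i U *m (col i V)^t*).

(* The left and right singular vectors are the columns of U and V. *)
Record is_svd (R : realType) (n : nat) (A : 'M[R[i]]_n) (s : 'I_n -> R)
    (U V : 'M[R[i]]_n) : Prop :=
  IsSvd {
    svd_ge0 : forall i, 0 <= s i;
    svd_noninc : forall i j : 'I_n, (i <= j)%N -> s j <= s i;
    svd_left : U \is unitarymx;
    svd_right : V \is unitarymx;
    svd_sum : A = \sum_(i < n) svd_term s U V i }.

Definition is_rank_one_approx (R : realType) (n : nat) (A B : 'M[R[i]]_n)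
    : Prop :=
  exists (s : 'I_n -> R) (U V : 'M[R[i]]_n) (i : 'I_n),
    [/\ is_svd A s U V,
        forall j, `|\tr (svd_term s U V j)| <= `|\tr (svd_term s U V i)|
      & B = svd_term s U V i].

(* Main.v *)
Require Import Defs.
From HB Require Import structures.
From mathcomp Require Import all_boot all_order all_algebra all_field.
From mathcomp Require Import finmap complex.
From mathcomp Require Import all_classical all_reals all_analysis.
From mathcomp Require Import ring lra.

(** Upper bound: in a singular value decomposition A = U S V^* one has
    s_i u_i v_i^* = (u_i u_i^* ) A, and the projections u_i u_i^* have entries of
    modulus at most 1, so N (P A) <= c N A with c independent of A.

    Lower bound: tr A is the sum of the traces of the n singular terms, so
    |tr A| <= n |tr (P A)|, and |tr B| is at most the joint spectral radius of any
    set containing the rank one matrix B. It remains to see that traces of products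
    control the joint spectral radius: if |tr A| <= C t^k for all A in F_k and all k,
    then rho(F) <= t. Let Alg be the unital algebra spanned by the products, and J the
    radical of its trace form. Since J consists of traceless matrices and is closed
    under products, it is nilpotent. A product A in F_k is determined modulo J by
    finitely many traces tr (A w), with w a product, so A = B + j with N B <= C' t^k
    and j in J; expanding a product of M such sums, the terms with many factors in J
    vanish, so F_(k M) grows at most like (C' t^k + e)^M in M. *)

Set Implicit Arguments.
Unset Strict Implicit.
Unset Printing Implicit Defensive.

Import Order.TTheory GRing.Theory Num.Theory.
Import numFieldNormedType.Exports.

Local Open Scope fset_scope.
Local Open Scope complex_scope.
Local Open Scope sesquilinear_scope.
Local Open Scope classical_set_scope.
Local Open Scope ring_scope.

(** * Nilpotency of traceless matrices and of spaces of nilpotent elements *)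

Lemma mxtrace_idempotent (K : fieldType) n (e : 'M[K]_n) :
  e *m e = e -> \tr e = (\rank e)%:R.
Proof.
move=> ee; have base1 : row_base e *m col_base e = 1%:M.
  apply: (row_full_inj (col_base_full e)); apply: (row_free_inj (row_base_free e)).
  by rewrite mulmx1 mulmxA -mulmxA mulmx_base.
by rewrite -{1}[e]mulmx_base mxtrace_mulC base1 mxtrace1.
Qed.

(** With [char_poly a = q * 'X ^+ m] and [q.[0] != 0], the element [e] projects onto the part where
    [a] is invertible. It is a polynomial in [a] without constant term, hence traceless; in
    characteristic zero an idempotent of trace zero has rank zero, and [e = 0] leaves
    [a ^+ m = 0]. *)
Lemma traceless_powers_nilpotent (K : numFieldType) n (a : 'M[K]_n.+1) :
  (forall m, \tr (a ^+ m.+1) = 0) -> exists m, a ^+ m = 0.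
Proof.
move=> tra; have [m [q]] := multiplicity_XsubC (char_poly a) 0.
rewrite monic_neq0 ?char_poly_monic //= subr0 => q0 def_p.
(* The exponent [m.+1] instead of [m] removes the constant term of [v * 'X ^+ m.+1] even if
   [m = 0]. *)
have /Bezout_eq1_coprimepP [[u v] /= uv1] : coprimep q ('X ^+ m.+1).
  by rewrite coprimep_expr // -['X]subr0 coprimep_XsubC.
have CH : horner_mx a (q * 'X ^+ m) = 0 by rewrite -def_p Cayley_Hamilton.
set e := horner_mx a (v * 'X ^+ m.+1).
have e1 : e = 1 - horner_mx a (u * q).
  by rewrite /e -(rmorph1 (horner_mx a)) -uv1 rmorphD /= addrAC subrr add0r.
have ee : e *m e = e.
  rewrite {2}e1 mulmxE mulrBr mulr1 /e -rmorphM /= exprS.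
  rewrite (_ : v * _ * _ = v * u * 'X * (q * 'X ^+ m)); last by ring.
  by rewrite [X in _ - X]rmorphM /= CH mulr0 subr0.
have tre : \tr e = 0.
  rewrite /e rmorphM /= rmorphXn /= horner_mx_X -[v]coefK poly_def.
  rewrite rmorph_sum /= mulr_suml raddf_sum big1 // => i _.
  rewrite /= horner_mxZ rmorphXn /= horner_mx_X -scalerAl -exprD mxtraceZ.
  by rewrite addnS tra mulr0.
have e0 : e = 0.
  apply/eqP; rewrite -mxrank_eq0 -(pnatr_eq0 K) -mxtrace_idempotent //.
  exact/eqP.
exists m; rewrite -[LHS]mul1r.
have -> : 1 = horner_mx a (u * q) by apply/eqP; rewrite -subr_eq0 -e1 e0.
by rewrite -{2}(horner_mx_X a) -rmorphXn /= -rmorphM /= -mulrA rmorphM /= CH mulr0.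
Qed.

(** By dimension the powers of [J] stabilise at some [I] with [I * I = I]. Such an [I] kills every
    [L] that it maps into itself, by induction on [\dim L]: for [x] in [L], either [I * <[x]>] is
    smaller than [L], hence killed by [I] and so zero, or it is all of [L], whence [x = b * x] with
    [b] nilpotent and [x = 0]. Then [I = I * I = 0]. *)
Lemma nil_subspace_nilpotent (K : fieldType) (aT : falgType K) (J : {vspace aT}) :
    (J * J <= J)%VS -> {in J, forall a, exists m, a ^+ m = 0} ->
  exists m, (J ^+ m = 0)%VS.
Proof.
move=> JJ nilJ.
have JS k : (J ^+ k.+2 <= J ^+ k.+1)%VS.
  by rewrite expvSr (expvSr _ k) -prodvA prodvSr.
have Jle k l : (J ^+ (k + l).+1 <= J ^+ k.+1)%VS.
  by elim: l => [|l IH]; rewrite ?addn0 // addnS (subv_trans (JS _)).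
have [m Jm] : exists m, (J ^+ m.+1 * J ^+ m.+1 = J ^+ m.+1)%VS.
  suff: forall d m, (\dim (J ^+ m.+1) < d)%N ->
      exists m, (J ^+ m.+1 * J ^+ m.+1 = J ^+ m.+1)%VS.
    by move/(_ _ 0%N (leqnn _)).
  elim=> // d IH m le_d; rewrite ltnS in le_d.
  have [lt_m|le_m] := ltnP (\dim (J ^+ (m + m.+1).+1)) (\dim (J ^+ m.+1)).
    by apply: (IH (m + m.+1)%N); apply: leq_trans lt_m le_d.
  by exists m; apply/eqP; rewrite -expvD addSn eqEdim Jle.
set I := (J ^+ m.+1)%VS in Jm; exists m.+1; rewrite -/I.
have IJ : (I <= J)%VS by have := Jle 0%N m.
suff noL d (L : {vspace aT}) : (\dim L < d)%N -> (I * L <= L)%VS -> (I * L = 0)%VS.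
  by rewrite -Jm; apply: (noL (\dim I).+1); rewrite ?Jm.
elim: d L => // d IH L; rewrite ltnS => dL IL.
apply/eqP; rewrite -subv0; apply/prodvP=> a x aI xL.
rewrite -[0%VS](_ : I * <[x]> = 0)%VS; first exact: memv_mul (memv_line x).
have Lx : (I * <[x]> <= L)%VS by rewrite (subv_trans _ IL) // prodvSr // -memvE.
have [ltL|leL] := ltnP (\dim (I * <[x]>)) (\dim L).
  by rewrite -[in LHS]Jm -prodvA IH ?(leq_trans ltL) // prodvA Jm.
have /memv_cosetP[b bI xE] : x \in (I * <[x]>)%VS.
  by have /eqP-> : (I * <[x]> == L)%VS by rewrite eqEdim Lx.
have [k bk] := nilJ b (subvP IJ b bI).
have -> : x = 0.
  have: x = b ^+ k * x.
    by elim: k {bk} => [|k IHk]; rewrite ?mul1r // exprSr -mulrA -xE.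
  by rewrite bk mul0r.
by rewrite prodv0.
Qed.

Lemma traceless_subspace_nilpotent (K : numFieldType) n (J : {vspace 'M[K]_n.+1}) :
    (J * J <= J)%VS -> {in J, forall a, \tr a = 0} -> exists m, (J ^+ m = 0)%VS.
Proof.
move=> JJ trJ; apply: (nil_subspace_nilpotent JJ) => a aJ.
apply: traceless_powers_nilpotent => m; apply: trJ.
elim: m => // m IH; rewrite exprS; apply: (subvP JJ); exact: memv_mul.
Qed.

(** * Growth rates, Fekete's lemma and limits superior *)

Lemma near_geometric_le (R : realType) (C x y : R) : 0 <= x -> x < y ->
  \forall k \near \oo, C * x ^+ k <= y ^+ k.
Proof.
move=> x0 xy; have y0 : 0 < y by exact: le_lt_trans xy.
have cv : C * (x / y) ^+ k @[k --> \oo] --> (0 : R).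
  rewrite -[0](mulr0 C); apply: cvgM; first exact: cvg_cst.
  by apply: cvg_expr; rewrite ger0_norm ?ltr_pdivrMr ?mul1r // divr_ge0 // ltW.
have cv1 := @cvgr_le _ _ _ _ _ _ cv _ ltr01; near=> k.
have : C * (x / y) ^+ k <= 1 by near: k; exact: cv1.
by rewrite expr_div_n mulrA ler_pdivrMr ?exprn_gt0 // mul1r.
Unshelve. all: by end_near.
Qed.

(** The factor [C] disappears under [k]-th roots; this strips constants from the growth estimates
    below. *)
Lemma geometric_dominated_le (R : realType) (C x y : R) : 0 <= x -> 0 <= y ->
  (forall k, y ^+ k.+1 <= C * x ^+ k.+1) -> y <= x.
Proof.
move=> x0 y0 yx; rewrite leNgt; apply/negP => xy.
have [m1 m2] := midf_lt xy; set m := (x + y) / 2 in m1 m2.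
have [K _ HK] := near_geometric_le C x0 m1.
have := le_trans (yx K) (HK K.+1 (leqnSn K)).
by rewrite leNgt ltr_pXn2r ?nnegrE ?(le_trans x0 (ltW m1)) ?m2 ?y0.
Qed.

Lemma powR_rootK (R : realType) (k : nat) (a : R) : 0 <= a ->
  (a `^ k.+1%:R^-1) ^+ k.+1 = a.
Proof.
move=> a0; rewrite -powR_mulrn ?powR_ge0 //.
by rewrite -powRrM mulVf ?pnatr_eq0 // powRr1.
Qed.

Lemma powR_root_le (R : realType) (k : nat) (a x : R) : 0 <= a -> 0 <= x ->
  (a `^ k.+1%:R^-1 <= x) = (a <= x ^+ k.+1).
Proof.
by move=> a0 x0; rewrite -(@ler_pXn2r _ k.+1) ?nnegrE ?powR_ge0 // powR_rootK.
Qed.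

Lemma fekete_bound (R : realType) (u : nat -> R) (p : nat) (x : R) :
    (forall k, 0 <= u k) -> (forall j k, u (j + k)%N <= u j * u k) ->
    0 < x -> u p.+1 <= x ^+ p.+1 ->
  (* After blocks of length [p.+1] are split off, a remainder of length at most [p] is left, which
     the sum in the witness absorbs; its summand [1] makes it positive. *)
  exists2 C, 0 < C & forall k, u k <= C * x ^+ k.
Proof.
move=> u0 uM x0 up; exists (1 + \sum_(r < p.+1) u r / x ^+ r).
  by rewrite ltr_pwDl // sumr_ge0 // => i _; rewrite divr_ge0 // exprn_ge0 // ltW.
elim/ltn_ind => k IH; have [kp|pk] := ltnP k p.+1.
  rewrite -ler_pdivrMr ?exprn_gt0 // (bigD1 (Ordinal kp)) //= addrCA lerDl.
  by rewrite addr_ge0 // sumr_ge0 // => i _; rewrite divr_ge0 // exprn_ge0 // ltW.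
rewrite -(subnKC pk) (le_trans (uM _ _)) // exprD mulrCA ler_pM // IH //.
by rewrite ltn_subrL (leq_trans _ pk).
Qed.

(** The limit is the infimum of the [k]-th roots of [u k] over [k > 0], which yields both bounds.
    Index [0] stays out of [E], since [0%:R^-1 = 0] makes that root [1] whatever [u] is. *)
Lemma fekete (R : realType) (u : nat -> R) (r := limn (fun k => u k `^ k%:R^-1)) :
    (forall k, 0 <= u k) -> (forall j k, u (j + k)%N <= u j * u k) ->
  [/\ 0 <= r, forall k, r ^+ k.+1 <= u k.+1
    & forall x, r < x -> exists2 C, 0 < C & forall k, u k <= C * x ^+ k].
Proof.
move=> u0 uM; pose v k := u k `^ k%:R^-1.
pose E := [set v k.+1 | k in [set: nat]]%classic.
have E0 : lbound E 0 by move=> _ [k _ <-]; exact: powR_ge0.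
have infE : has_inf E by split; [exists (v 1%N); exists 0%N | exists 0].
have leE k : inf E <= v k.+1 by apply: ge_inf; [exists 0 | exists k].
have infE0 : 0 <= inf E by apply: lb_le_inf => //; case: infE.
have big x : inf E < x -> exists2 C, 0 < C & forall k, u k <= C * x ^+ k.
  move=> Ex; have x0 : 0 < x by exact: le_lt_trans Ex.
  have [|_ [p _ <-] vx] := inf_lt _ Ex; first by case: infE.
  by apply: (@fekete_bound _ _ p) => //; rewrite -powR_root_le ?(ltW x0) // ltW.
have vE : v k @[k --> \oo] --> inf E.
  apply/cvgrPdist_le => e e0.
  have [C C0 uC] := big (inf E + e / 2) ltac:(by rewrite ltrDl divr_gt0).
  have xy : inf E + e / 2 < inf E + e by lra.
  have x0 : 0 <= inf E + e / 2 by rewrite addr_ge0 // divr_ge0 // ltW.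
  near=> k; have k0 : (0 < k)%N by near: k; exists 1%N.
  rewrite -(prednK k0) ler_distlC lerBlDr.
  apply/andP; split; first by rewrite (le_trans (leE k.-1)) // lerDl ltW.
  rewrite /v powR_root_le ?addr_ge0 ?(ltW e0) // prednK //.
  by apply: le_trans (uC _) _; near: k; exact: near_geometric_le x0 xy.
have -> : r = inf E by apply: cvg_lim.
split=> // k; rewrite -[leRHS](powR_rootK k) //.
by rewrite ler_pXn2r ?nnegrE ?powR_ge0 ?leE.
Unshelve. all: by end_near.
Qed.

(** The limsup is the infimum of the tail suprema [esups]: the first hypothesis bounds this infimum
    above by [r], the second bounds every tail supremum below by [r]. *)
Lemma EFin_limn_esup (R : realType) (v : nat -> R) (r : R) :
    (forall x, r < x -> \forall k \near \oo, v k <= x) ->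
    (forall x, (\forall k \near \oo, v k <= x) -> r <= x) ->
  r%:E = limn_esup (fun k => (v k)%:E).
Proof.
move=> rub rlb; rewrite limn_esup_lim (cvg_lim _ (@cvg_esups_inf _ _)) //.
apply/eqP; rewrite eq_le; apply/andP; split.
  apply: le_ereal_inf_tmp => _ [m _ <-].
  have ub k : (m <= k)%N -> ((v k)%:E <= esups (fun k => (v k)%:E) m)%E.
    by move=> mk; apply: ereal_sup_ubound; exists k.
  (* A tail supremum may be [+oo], which bounds everything; [-oo] is excluded because it would
     dominate the real [v m]. *)
  case: esups ub => [x| |] ub; last 2 first.
  - by rewrite leey.
  - by have := ub m (leqnn m).
  by rewrite lee_fin; apply: rlb; exists m => // k /= /ub; rewrite lee_fin.
apply/lee_addgt0Pr => e e0; rewrite -EFinD.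
have [m _ mv] := rub (r + e) ltac:(by rewrite ltrDl).
apply: ge_ereal_inf; exists (esups (fun k => (v k)%:E) m); first by exists m.
by apply: ge_ereal_sup => _ [k /= mk <-]; rewrite lee_fin mv.
Qed.

(** * The trace form and its radical *)

Lemma mxtrace_sum (K : pzSemiRingType) n I (r : seq I) (P : pred I)
    (F : I -> 'M[K]_n) :
  \tr (\sum_(i <- r | P i) F i) = \sum_(i <- r | P i) \tr (F i).
Proof. exact: raddf_sum. Qed.

Lemma memv_prod_span (K : fieldType) (aT : falgType K) (X Y : seq aT)
    (Z : {vspace aT}) :
  (forall x y, x \in X -> y \in Y -> x * y \in Z) -> (<<X>> * <<Y>> <= Z)%VS.
Proof.
move=> XYZ; apply/prodvP => u v uX vY.
rewrite (coord_span (X := in_tuple X) uX) mulr_suml memv_suml // => i _.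
rewrite (coord_span (X := in_tuple Y) vY) mulr_sumr memv_suml // => j _.
by rewrite -scalerAl -scalerAr !memvZ // XYZ // mem_nth //=.
Qed.

(** Recovers [a] modulo the radical from finitely many traces. The Gram matrix [Q] of the trace form
    may be singular, so a pseudo-inverse serves: [c *m Q] lies in the row space of [Q], hence
    [c *m Q *m pinvmx Q *m Q = c *m Q]. *)
Lemma trace_form_projection (K : fieldType) n (ws : seq 'M[K]_n.+1) :
  exists D : 'I_(size ws) -> 'M[K]_n.+1, (forall j, D j \in <<ws>>%VS) /\
    {in <<ws>>%VS &, forall a b,
      \tr ((a - \sum_(j < size ws) \tr (a * ws`_j) *: D j) * b) = 0}.
Proof.
pose Q := \matrix_(i < size ws, j < size ws) \tr (ws`_i * ws`_j).
exists (fun j => \sum_i pinvmx Q j i *: ws`_i); split=> [j|a b aw bw].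
  by rewrite memv_suml // => i _; rewrite memvZ // memv_span // mem_nth.
suff trw (l : 'I_(size ws)) :
    \tr ((a - \sum_(j < size ws) \tr (a * ws`_j) *:
      (\sum_i pinvmx Q j i *: ws`_i)) * ws`_l) = 0.
  rewrite (coord_span (X := in_tuple ws) bw) mulr_sumr mxtrace_sum big1 //= => l _.
  by rewrite -scalerAr mxtraceZ trw mulr0.
pose c := \row_i coord (in_tuple ws) i a.
have cQ j : (c *m Q) 0 j = \tr (a * ws`_j).
  rewrite [in RHS](coord_span (X := in_tuple ws) aw) mulr_suml mxtrace_sum mxE.
  by apply: eq_bigr => i _; rewrite -scalerAl /= mxtraceZ !mxE.
have /(congr1 (fun M : 'rV_(size ws) => M 0 l)) := mulmxKpV (submxMl c Q).
rewrite [in LHS]mxE cQ => trE; apply/eqP.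
rewrite mulrBl raddfB subr_eq0 /= -trE mulr_suml mxtrace_sum; apply/eqP.
under [LHS]eq_bigr => j _ do rewrite mxE mulr_suml.
rewrite exchange_big; apply: eq_bigr => i _.
rewrite -scalerAl mxtraceZ -cQ mulr_suml mxtrace_sum mulr_sumr.
by apply: eq_bigr => j _; rewrite -scalerAl mxtraceZ [Q _ _]mxE mulrA.
Qed.

(** [J] is the radical, obtained as the kernel of the pairings with a basis of [A]. Cyclicity of the
    trace makes it stable under left multiplication by [A], and pairing with [1] shows its elements
    traceless. *)
Lemma trace_radical (K : numFieldType) n (A : {aspace 'M[K]_n.+1}) :
    1 \in A ->
  exists (J : {vspace 'M[K]_n.+1}) m,
    [/\ (A * J <= J)%VS, (J ^+ m.+1 = 0)%VS
      & {in A, forall a, (forall b, b \in A -> \tr (a * b) = 0) -> a \in J}].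
Proof.
move=> A1; pose f a : 'rV[K]_(\dim A) := \row_j \tr (a * (vbasis A)`_j).
have flin : linear f.
  by move=> k u v; apply/rowP => j; rewrite !mxE mulrDl -scalerAl raddfD /= mxtraceZ.
pose fL : {linear _ -> _} := HB.pack f (GRing.isLinear.Build _ _ _ _ _ flin).
pose J := (A :&: lker (linfun fL))%VS.
have memJ a : a \in J <-> a \in A /\ (forall b, b \in A -> \tr (a * b) = 0).
  rewrite memv_cap memv_ker lfunE /=; split=> [/andP[aA /eqP fa0]|[aA tra]].
    split=> // b bA; rewrite (coord_vbasis bA) mulr_sumr mxtrace_sum big1 //= => i _.
    rewrite -scalerAr mxtraceZ.
    by have /rowP/(_ i) := fa0; rewrite !mxE => ->; rewrite mulr0.
  rewrite aA; apply/eqP/rowP => j; rewrite !mxE tra // vbasis_mem // mem_nth //.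
  by rewrite size_tuple.
have AJ : (A * J <= J)%VS.
  apply/prodvP => a x aA /memJ[xA trx]; apply/memJ; split=> [|b bA].
    exact: memvM.
  by rewrite -mulrA -mulmxE mxtrace_mulC mulmxE -mulrA trx // memvM.
have JJ : (J * J <= J)%VS by apply: subv_trans AJ; rewrite prodvSl // capvSl.
have [a /memJ[aA tra]|m Jm] := traceless_subspace_nilpotent JJ.
  by rewrite -[a]mulr1 tra.
exists J, m; split=> //; first by rewrite expvSl Jm prodv0.
by move=> a aA tra; apply/memJ.
Qed.

(** * Submultiplicative norms, products of length [k] and the joint spectral radius *)

Lemma normr_normc (R : rcfType) (z : R[i]) : `|z| = (Normc.normc z)%:C.
Proof. by case: z => a b; rewrite normc_def. Qed.

Lemma normc_ge0 (R : rcfType) (z : R[i]) : 0 <= Normc.normc z.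
Proof. by case: z => a b; rewrite /= sqrtr_ge0. Qed.

Lemma ler_normc_sum (R : rcfType) I (r : seq I) (P : pred I) (F : I -> R[i]) :
  Normc.normc (\sum_(i <- r | P i) F i) <= \sum_(i <- r | P i) Normc.normc (F i).
Proof.
apply: (big_ind2 (fun z x => Normc.normc z <= x)) => //; first by rewrite Normc.normc0.
by move=> z x w y zx wy; rewrite (le_trans (le_normcD _ _)) ?lerD.
Qed.

Section SubmultiplicativeNorm.
Context (R : realType) (n : nat) (N : 'M[R[i]]_n -> R) (hN : submult_mxnorm N).
Implicit Types (A B : 'M[R[i]]_n) (F : {fset 'M[R[i]]_n}).

Lemma mxnormZ (c : R[i]) A : N (c *: A) = Normc.normc c * N A.
Proof. by apply: (@complexI R); rewrite (mxnorm_scale hN) normr_normc rmorphM. Qed.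

Lemma mxnorm0 : N 0 = 0.
Proof. by rewrite -(scale0r 0) mxnormZ Normc.normc0 mul0r. Qed.

Lemma mxnorm_sub A B : N (A - B) <= N A + N B.
Proof.
rewrite (le_trans (mxnorm_triangle hN _ _)) // lerD2l -scaleN1r mxnormZ.
by rewrite normcN Normc.normc1 mul1r.
Qed.

Lemma mxnorm_sum I (r : seq I) (P : pred I) (G : I -> 'M[R[i]]_n) :
  N (\sum_(i <- r | P i) G i) <= \sum_(i <- r | P i) N (G i).
Proof.
apply: (big_ind2 (fun A x => N A <= x)) => //; first by rewrite mxnorm0.
by move=> A x B y Ax By; rewrite (le_trans (mxnorm_triangle hN _ _)) ?lerD.
Qed.

Lemma mxnorm_le_entries A :
  N A <= \sum_i \sum_j Normc.normc (A i j) * N (delta_mx i j).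
Proof.
rewrite {1}(matrix_sum_delta A) (le_trans (mxnorm_sum _ _ _)) // ler_sum // => i _.
rewrite (le_trans (mxnorm_sum _ _ _)) // ler_sum // => j _.
by rewrite mxnormZ.
Qed.

Lemma prods_mul F j k A B :
  A \in prods F j -> B \in prods F k -> A *m B \in prods F (j + k).
Proof.
elim: j A => [|j IH] A /=; first by rewrite inE => /eqP-> Bk; rewrite mul1mx.
move=> /imfset2P[C CF [D DF ->]] BF.
rewrite -mulmxA in_imfset2 //; exact: IH.
Qed.

Lemma prods_split F j k A : A \in prods F (j + k) ->
  exists B C, [/\ B \in prods F j, C \in prods F k & A = B *m C].
Proof.
elim: j A => [|j IH] A /=.
  by move=> AF; exists 1%:M, A; rewrite inE mul1mx.
move=> /imfset2P[C CF [D /IH[D1 [D2 [D1F D2F ->]]] ->]].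
by exists (C *m D1), D2; rewrite mulmxA in_imfset2.
Qed.

Lemma prods1 F : prods F 1 = F.
Proof.
apply/fsetP => A; apply/imfset2P/idP => [[B BF [C]]|AF].
  by rewrite inE => /eqP-> ->; rewrite mulmx1.
by exists A => //; exists 1%:M; rewrite ?inE ?mulmx1.
Qed.

Lemma prods_prods F k m A : A \in prods F (k * m) -> A \in prods (prods F k) m.
Proof.
elim: m A => [|m IH] A; first by rewrite muln0.
by rewrite mulnS => /prods_split[B [C [BF /IH CF ->]]]; rewrite in_imfset2.
Qed.

Definition max_mxnorm F := \big[Num.max/0]_(A <- F) N A.

Lemma max_mxnorm_ge0 F : 0 <= max_mxnorm F.
Proof. exact: bigmax_ge_id. Qed.

Lemma le_max_mxnorm F A : A \in F -> N A <= max_mxnorm F.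
Proof. by move=> AF; apply: le_bigmax_seq. Qed.

Lemma max_mxnorm_le F c : 0 <= c -> {in F, forall A, N A <= c} -> max_mxnorm F <= c.
Proof. by move=> c0 Fc; rewrite /max_mxnorm big_seq; apply: bigmax_le. Qed.

Lemma max_mxnorm_prods_submult F j k :
  max_mxnorm (prods F (j + k)) <= max_mxnorm (prods F j) * max_mxnorm (prods F k).
Proof.
apply: max_mxnorm_le => [|A /prods_split[B [C [BF CF ->]]]].
  by rewrite mulr_ge0 ?max_mxnorm_ge0.
by rewrite (le_trans (mxnorm_mul hN _ _)) // ler_pM ?(mxnorm_ge0 hN) ?le_max_mxnorm.
Qed.

Let jsr_fekete F :=
  fekete (fun k => max_mxnorm_ge0 (prods F k)) (max_mxnorm_prods_submult F).

Lemma jsr_ge0 F : 0 <= jsr N F.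
Proof. by have [] := jsr_fekete F. Qed.

Lemma jsr_pow_le F k c : 0 <= c -> {in prods F k.+1, forall A, N A <= c} ->
  jsr N F ^+ k.+1 <= c.
Proof.
move=> c0 Fc; have [_ H _] := jsr_fekete F.
by apply: le_trans (H k) _; apply: max_mxnorm_le.
Qed.

Lemma jsr_lt_bound F x : jsr N F < x ->
  exists2 C, 0 < C & forall k, {in prods F k, forall A, N A <= C * x ^+ k}.
Proof.
move=> Fx; have [_ _ H] := jsr_fekete F.
have [C C0 FC] := H _ Fx; exists C => // k A AF.
by apply: le_trans (FC k); apply: le_max_mxnorm.
Qed.

End SubmultiplicativeNorm.

(** * Traces of products control the joint spectral radius *)

Lemma prods_agenv (R : realType) n (F : {fset 'M[R[i]]_n.+1}) k A :
  A \in prods F k -> A \in agenv <<F>>%VS.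
Proof.
elim: k A => [|k IH] A /=.
  by rewrite inE => /eqP->; rewrite (subvP (sub1_agenv _)) ?memv_line.
move=> /imfset2P[B BF [C /IH CF ->]].
by rewrite memvM // (subvP (sub_agenv _)) ?memv_span.
Qed.

(** The generated algebra is a sum of finitely many powers of [<<F>>], and the [l]-th power is
    spanned by the products of length [l]. *)
Lemma agenv_words (R : realType) n (F : {fset 'M[R[i]]_n.+1}) :
  exists2 ws : seq 'M[R[i]]_n.+1, agenv <<F>>%VS = <<ws>>%VS
    & {in ws, forall w, exists l, w \in prods F l}.
Proof.
pose ws d := flatten [seq enum_fset (prods F l) | l <- iota 0 d].
have wsF d w : w \in ws d -> exists2 l, (l < d)%N & w \in prods F l.
  by move=> /flatten_mapP[l]; rewrite mem_iota => ld wF; exists l.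
have wordsE d : (\sum_(i < d) <<F>> ^+ i <= <<ws d>>)%VS.
  have expF l : (<<F>> ^+ l <= <<prods F l>>)%VS.
    elim: l => [|l IH]; first by rewrite -memvE memv_span //= inE.
    rewrite expvSl (subv_trans (prodvSr _ IH)) //.
    by apply: memv_prod_span => x y xF yF; rewrite memv_span //= in_imfset2.
  apply/subv_sumP => l _; rewrite (subv_trans (expF l)) //; apply: sub_span => A AF.
  by apply/flatten_mapP; exists (nat_of_ord l); rewrite ?mem_iota ?add0n ?ltn_ord.
exists (ws (\dim {:'M[R[i]]_n.+1})) => [|w /wsF[l _ wl]]; last by exists l.
apply/eqP; rewrite eqEsubv wordsE; apply/span_subvP => w /wsF[l _].
exact: prods_agenv.
Qed.

(* The weights [(K / (y - c)) ^+ l] on the layers [J ^+ l * A] absorb the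
   binomial coefficients of the expansion of a product of [k] factors. *)
Lemma filtered_products_bound (R : realType) n (N : 'M[R[i]]_n.+1 -> R)
    (A : {aspace 'M[R[i]]_n.+1}) (J : {vspace 'M[R[i]]_n.+1}) (m : nat)
    (G : {fset 'M[R[i]]_n.+1}) (c K y : R) :
    submult_mxnorm N -> 1 \in A -> (A * J <= J)%VS -> (J ^+ m.+1 = 0)%VS ->
    0 <= c -> 0 <= K -> c < y ->
    {in G, forall X, exists B, [/\ B \in A, X - B \in J, N B <= c
      & N (X - B) <= K]} ->
  exists C, forall k, {in prods G k, forall X, N X <= C * y ^+ k}.
Proof.
move=> hN A1 AJ Jm c0 K0 cy decG; pose t := K / (y - c).
have yc : 0 < y - c by rewrite subr_gt0.
have y0 : 0 <= y by rewrite ltW // (le_lt_trans c0).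
have t0 : 0 <= t by rewrite divr_ge0 // ltW.
(* This identity dictates the choice of [t]: it makes the recursion on the layers close with ratio
   exactly [y]. *)
have ty : c * t + K = t * y by rewrite /t; field; rewrite gt_eqF.
pose E l := (J ^+ l * A)%VS.
have AE l : (A * E l <= E l)%VS.
  case: l => [|l]; first by rewrite /E expv0 prod1v asubv.
  by rewrite /E expvSl !prodvA !prodvSl.
have JE l : (J * E l = E l.+1)%VS by rewrite /E expvSl prodvA.
have E0 : E m.+1 = 0%VS by rewrite /E Jm prod0v.
exists (\sum_(l < m.+1) t ^+ l * N 1) => k X XG.
suff [p [-> pE]] : exists p : nat -> 'M[R[i]]_n.+1, X = \sum_(l < m.+1) p l /\
    forall l, p l \in E l /\ N (p l) <= t ^+ l * N 1 * y ^+ k.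
  rewrite (le_trans (mxnorm_sum hN _ _ _)) // mulr_suml ler_sum // => l _.
  by have [] := pE l.
elim: k X XG => [|k IH] X /=.
  rewrite inE => /eqP->; exists (fun l => if l is 0%N then 1 else 0); split.
    by rewrite big_ord_recl big1 ?addr0.
  case=> [|l]; first by rewrite /E expv0 prod1v A1 expr0 mul1r mulr1.
  by rewrite mem0v (mxnorm0 hN) mulr1 mulr_ge0 ?exprn_ge0 ?(mxnorm_ge0 hN).
move=> /imfset2P[Y YG [Z /IH[p [-> pE]] ->]].
have [B [BA YB NB NYB]] := decG Y YG.
(* Multiplication by [B] preserves each layer and multiplication by [Y - B] raises it by one; what
   leaves the last layer lies in [E m.+1 = 0]. *)
exists (fun l => B * p l + (if l is l'.+1 then (Y - B) * p l' else 0)); split.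
  rewrite big_split /= -mulr_sumr [X in _ + X]big_ord_recl add0r /=.
  rewrite mulmxE -{1}[Y](subrK B) mulrDl addrC; congr (_ + _).
  rewrite mulr_sumr big_ord_recr /= -[RHS]addr0; congr (_ + _).
  apply/eqP; rewrite -memv0 -E0 -JE memv_mul //; exact: (pE m).1.
have NM P Q a b : 0 <= a -> N P <= a -> N Q <= b -> N (P * Q) <= a * b.
  move=> a0 Pa Qb; rewrite (le_trans (mxnorm_mul hN _ _)) // ler_pM //.
  - exact: (mxnorm_ge0 hN).
  - exact: (mxnorm_ge0 hN).
case=> [|l].
  have [p0E p0N] := pE 0%N; split.
    by rewrite addr0 (subvP (AE 0%N)) // memv_mul.
  rewrite addr0 (le_trans (NM _ _ _ _ c0 NB p0N)) // exprS mulrCA ler_wpM2l //.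
    by rewrite mulr_ge0 ?exprn_ge0 ?(mxnorm_ge0 hN).
  by rewrite ler_wpM2r ?exprn_ge0 // ltW.
have [p1E p1N] := pE l.+1; have [p0E p0N] := pE l; split.
  rewrite memvD //; first by rewrite (subvP (AE _)) // memv_mul.
  by rewrite -JE memv_mul.
rewrite (le_trans (mxnorm_triangle hN _ _)) //.
rewrite (le_trans (lerD (NM _ _ _ _ c0 NB p1N) (NM _ _ _ _ K0 NYB p0N))) //.
rewrite le_eqVlt; apply/orP; left; apply/eqP.
transitivity (t ^+ l * N 1 * y ^+ k * (c * t + K)); first by rewrite exprS; ring.
by rewrite ty !exprS; ring.
Qed.

Lemma trace_bound_jsr_le (R : realType) n (N : 'M[R[i]]_n.+1 -> R)
    (F : {fset 'M[R[i]]_n.+1}) (C t : R) :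
    submult_mxnorm N -> 0 <= C -> 0 <= t ->
    (forall k, {in prods F k, forall A, Normc.normc (\tr A) <= C * t ^+ k}) ->
  jsr N F <= t.
Proof.
move=> hN C0 t0 trF; pose A := agenv_aspace <<F>>%VS.
have A1 : 1 \in A by rewrite (subvP (sub1_agenv _)) ?memv_line.
have [J [m [AJ Jm radJ]]] := trace_radical A1.
have [ws Aws wsF] := agenv_words F.
have [D [Dws projD]] := trace_form_projection ws.
have /choice[len lenP] (j : 'I_(size ws)) : exists l, ws`_j \in prods F l.
  by apply: wsF; rewrite mem_nth.
pose B X := \sum_(j < size ws) \tr (X * ws`_j) *: D j.
(* The [j]-th word has length [len j], so its product with an [X] of length [k] has trace of modulus
   at most [C * t ^+ (k + len j)]. *)
pose C1 := \sum_(j < size ws) C * t ^+ len j * N (D j).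
have C10 : 0 <= C1.
  by rewrite sumr_ge0 // => j _; rewrite !mulr_ge0 ?exprn_ge0 // (mxnorm_ge0 hN).
have BA X : B X \in A.
  by rewrite memv_suml // => j _; rewrite memvZ // -[_ \in A]/(_ \in agenv _) Aws.
have NB k X : X \in prods F k -> N (B X) <= C1 * t ^+ k.
  move=> XF; rewrite (le_trans (mxnorm_sum hN _ _ _)) // mulr_suml ler_sum // => j _.
  rewrite (mxnormZ hN) mulrAC ler_wpM2r ?(mxnorm_ge0 hN) // -mulrA -exprD addnC.
  exact: trF (prods_mul XF (lenP j)).
(* Two limits in turn: for fixed [k], the number of blocks of length [k.+1] grows and gives
   [jsr N F ^+ k.+1 <= C1 * t ^+ k.+1]; then [k] grows and removes [C1]. *)
apply: (@geometric_dominated_le _ C1) => // [|k]; first exact: jsr_ge0.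
apply/ler_addgt0Pr => e e0; set y := _ + e.
have yP : C1 * t ^+ k.+1 < y by rewrite ltrDl.
(* A crude bound on the radical parts suffices: it affects only the constant [C2], not the rate
   [y]. *)
pose K := max_mxnorm N (prods F k.+1) + C1 * t ^+ k.+1.
have [||X XF|C2 C2P] :=
  filtered_products_bound (G := prods F k.+1) (K := K) hN A1 AJ Jm _ _ yP.
- by rewrite mulr_ge0 ?exprn_ge0.
- by rewrite addr_ge0 ?max_mxnorm_ge0 ?mulr_ge0 ?exprn_ge0.
- exists (B X); split; rewrite ?BA ?NB //; last first.
    by rewrite (le_trans (mxnorm_sub hN _ _)) // lerD ?NB ?le_max_mxnorm.
  have XA := prods_agenv XF.
  apply: radJ => [|b bA]; first by rewrite memvB.
  by apply: projD; rewrite -Aws.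
apply: (@geometric_dominated_le _ C2) => [||q]; rewrite ?exprn_ge0 ?jsr_ge0 //.
  by rewrite (le_trans _ (ltW yP)) // mulr_ge0 ?exprn_ge0.
rewrite -exprM mulSn addSn; apply: (jsr_pow_le hN) => [|X].
  (* The empty product provides [0 <= C2]. *)
  have := C2P 0%N 1; rewrite inE eqxx expr0 mulr1 => /(_ isT) N1C.
  rewrite mulr_ge0 ?exprn_ge0 ?(le_trans (mxnorm_ge0 hN _) N1C) //.
  by rewrite (le_trans _ (ltW yP)) // mulr_ge0 ?exprn_ge0.
by rewrite -addSn -mulSn => /prods_prods; exact: C2P.
Qed.

(** * Rank-one matrices *)

Lemma scaled_rank1_pow (K : comNzRingType) n (c : K)
    (u : 'cV[K]_n.+1) (v : 'rV[K]_n.+1) j (B := c *: (u *m v)) : B ^+ j.+1 = (\tr B) ^+ j *: B.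
Proof.
have BB : B * B = \tr B *: B.
  rewrite /B mxtraceZ mxtrace_mulC -mulmxE -scalemxAl -scalemxAr mulmxA.
  rewrite -[u *m v *m u]mulmxA [v *m u]mx11_scalar mxtrace_scalar mul_mx_scalar.
  by rewrite -!scalemxAl !scalerA; congr (_ *: _); ring.
elim: j => [|j IH]; first by rewrite expr0 scale1r.
by rewrite [LHS]exprS IH -scalerAr BB scalerA -exprSr.
Qed.

(** The trace is the only possibly nonzero eigenvalue of such a matrix [B]. The powers of [B] are
    products from [G], and their norms grow exactly like the powers of the modulus of [\tr B]. *)
Lemma rank1_trace_le_jsr (R : realType) n (N : 'M[R[i]]_n.+1 -> R)
    (G : {fset 'M[R[i]]_n.+1}) (c : R[i]) (u : 'cV_n.+1) (v : 'rV_n.+1) :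
    submult_mxnorm N -> c *: (u *m v) \in G ->
  Normc.normc (\tr (c *: (u *m v))) <= jsr N G.
Proof.
move=> hN; have powB := scaled_rank1_pow c u v.
move: (c *: (u *m v)) powB => B powB BG.
have [->|trB0] := eqVneq (\tr B) 0; first by rewrite Normc.normc0 jsr_ge0.
have NB0 : 0 < N B.
  rewrite lt_neqAle (mxnorm_ge0 hN) andbT eq_sym.
  apply: contra trB0 => /eqP /(mxnorm_eq0 hN) ->.
  by rewrite mxtrace0.
have tr_gt0 : 0 < Normc.normc (\tr B).
  rewrite lt_neqAle normc_ge0 andbT eq_sym.
  by apply: contra trB0 => /eqP /Normc.eq0_normc ->.
have BG' k : B ^+ k \in prods G k.
  elim: k => [|k IH] /=; first by rewrite inE.
  by rewrite exprS in_imfset2.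
rewrite leNgt; apply/negP => /midf_lt[]; set x := _ / 2 => ltx xlt.
have x0 : 0 <= x by rewrite (le_trans (jsr_ge0 hN G)) // ltW.
have [C C0 CP] := jsr_lt_bound hN ltx.
have := xlt; rewrite ltNge => /negP; apply.
apply: (@geometric_dominated_le _ (Normc.normc (\tr B) / N B * C)) => [||k] //.
  exact: normc_ge0.
have := CP _ _ (BG' k.+1); rewrite powB (mxnormZ hN) -ler_pdivlMr // => le_tr.
rewrite exprS -!mulrA [_^-1 * _]mulrC ler_wpM2l ?normc_ge0 //.
suff -> : Normc.normc (\tr B) ^+ k = Normc.normc (\tr B ^+ k) by [].
elim: k {le_tr} => [|k IH]; first by rewrite !expr0 Normc.normc1.
by rewrite !exprS Normc.normcM IH.
Qed.

(** * Singular terms and the limsup formula *)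

Lemma unitarymx_col_dot (C : numClosedFieldType) n (U : 'M[C]_n) i j :
  U \is unitarymx -> (col i U)^t* *m col j U = (i == j)%:R%:M.
Proof.
(* [unitarymx] asserts orthonormal rows; commuting the two inverse factors gives orthonormal
   columns. *)
move=> /unitarymxP/mulmx1C UU; apply/matrixP => a b; rewrite !ord1.
have /matrixP/(_ i j) := UU; rewrite !mxE => <-.
by apply: eq_bigr => k _; rewrite !mxE.
Qed.

Lemma unitarymx_entry_le1 (C : numClosedFieldType) n (U : 'M[C]_n) i j :
  U \is unitarymx -> `|U i j| <= 1.
Proof.
move=> /unitarymxP/matrixP/(_ i i); rewrite !mxE eqxx mulr1n => U1.
rewrite -(@ler_pXn2r _ 2) ?nnegrE // expr1n -U1 (bigD1 j) //= !mxE -normCK lerDl.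
by rewrite sumr_ge0 // => k _; rewrite !mxE -normCK exprn_ge0.
Qed.

Lemma svd_term_mulmx (R : realType) n (A : 'M[R[i]]_n) s U V i :
  is_svd A s U V -> svd_term s U V i = col i U *m (col i U)^t* *m A.
Proof.
move=> svdA; rewrite (svd_sum svdA) mulmx_sumr (bigD1 i) //= big1 ?addr0.
  rewrite /svd_term -scalemxAr mulmxA -[_ *m _ *m col i U]mulmxA.
  by rewrite (unitarymx_col_dot _ _ (svd_left svdA)) eqxx mulmx1.
move=> j /negPf ji; rewrite /svd_term -scalemxAr mulmxA -[_ *m _ *m col j U]mulmxA.
rewrite (unitarymx_col_dot _ _ (svd_left svdA)) eq_sym ji raddf0.
by rewrite mulmx0 mul0mx scaler0.
Qed.

Lemma mxnorm_svd_term_le (R : realType) n (N : 'M[R[i]]_n -> R)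
    (A : 'M[R[i]]_n) s U V i :
    submult_mxnorm N -> is_svd A s U V ->
  N (svd_term s U V i) <= (\sum_j \sum_k N (delta_mx j k)) * N A.
Proof.
move=> hN svdA; rewrite (svd_term_mulmx _ svdA) (le_trans (mxnorm_mul hN _ _)) //.
rewrite ler_wpM2r ?(mxnorm_ge0 hN) // (le_trans (mxnorm_le_entries hN _)) //.
rewrite ler_sum // => j _; rewrite ler_sum // => k _.
rewrite ler_piMl ?(mxnorm_ge0 hN) // -lecR -normr_normc.
rewrite mxE big_ord1 !mxE normrM norm_conjC.
by rewrite mulr_ile1 // (unitarymx_entry_le1 _ _ (svd_left svdA)).
Qed.

Lemma trace_le_rank_one_approx (R : realType) n (A B : 'M[R[i]]_n) :
  is_rank_one_approx A B -> Normc.normc (\tr A) <= n%:R * Normc.normc (\tr B).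
Proof.
move=> [s [U [V [i [svdA maxi ->]]]]].
rewrite (svd_sum svdA) mxtrace_sum (le_trans (ler_normc_sum _ _ _)) //.
rewrite mulr_natl -[n in _ *+ n]card_ord -sumr_const ler_sum // => j _.
by rewrite -lecR -!normr_normc.
Qed.

Theorem theorem4 (R : realType) (n : nat) (N : 'M[R[i]]_n -> R)
    (hN : submult_mxnorm N)
    (P : 'M[R[i]]_n -> 'M[R[i]]_n)
    (hP : forall A : 'M[R[i]]_n, is_rank_one_approx A (P A))
    (F : {fset 'M[R[i]]_n}) (hF : F != fset0) :
  (jsr N F)%:E =
  limn_esup (fun k : nat =>
    ((jsr N [fset P A | A in prods F k]) `^ (k%:R^-1))%:E).
Proof.
(* For [n = 0], [hP] is contradictory: it yields an index in ['I_0]. *)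
case: n => [|n] in N hN P hP F hF *; first by have [? [? [? [[]]]]] := hP 0.
set G := fun k => [fset P A | A in prods F k].
have jsr0 H := jsr_ge0 hN H.
pose c := \sum_(j < n.+1) \sum_(k < n.+1) N (delta_mx j k).
have c0 : 0 <= c.
  by rewrite !sumr_ge0 // => j _; rewrite sumr_ge0 // => k _; exact: mxnorm_ge0.
have NP A : N (P A) <= c * N A.
  by have [s [U [V [i [svdA _ ->]]]]] := hP A; exact: mxnorm_svd_term_le.
apply: EFin_limn_esup => x.
  move=> /midf_lt[]; set y := _ / 2 => Fy yx.
  have y0 : 0 <= y by rewrite (le_trans (jsr0 F)) // ltW.
  have [C C0 FC] := jsr_lt_bound hN Fy.
  near=> k; have k0 : (0 < k)%N by near: k; exists 1%N.
  rewrite -(prednK k0) powR_root_le ?prednK //; last by rewrite (le_trans y0) // ltW.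
  apply: (@le_trans _ _ (c * C * y ^+ k)); last by near: k; exact: near_geometric_le.
  (* With products of length one, the joint spectral radius is at most the largest norm in the
     set. *)
  rewrite -[jsr _ _]expr1; apply: (jsr_pow_le hN) => [|B].
    by rewrite !mulr_ge0 ?exprn_ge0 // ltW.
  rewrite prods1 => /imfsetP[A AF ->]; rewrite (le_trans (NP A)) //.
  by rewrite -mulrA ler_wpM2l // FC.
move=> [K _ HK].
have x0 : 0 <= x by apply: le_trans (powR_ge0 _ _) (HK K (leqnn K)).
have trF k A : A \in prods F k -> Normc.normc (\tr A) <= n.+1%:R * jsr N (G k).
  move=> AF; rewrite (le_trans (trace_le_rank_one_approx (hP A))) // ler_wpM2l //.
  have : P A \in G k by rewrite in_imfset.
  by have [s [U [V [i [_ _ ->]]]]] := hP A; exact: rank1_trace_le_jsr.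
(* Since [x] may be [0], the comparison runs with [y > 0], whose powers can be divided by. *)
apply/ler_addgt0Pr => e e0; set y := x + e.
have y0 : 0 < y by rewrite ltr_wpDl.
have term_ge0 k : 0 <= jsr N (G k) / y ^+ k.
  by rewrite divr_ge0 ?exprn_ge0 ?jsr0 // ltW.
(* [S] absorbs the indices up to [K]; the cut at [K.+1] puts index [0], where the root is
   degenerate, among them even if [K = 0]. *)
pose S := \sum_(k < K.+1) jsr N (G k) / y ^+ k.
have S0 : 0 <= S by rewrite sumr_ge0.
apply: (@trace_bound_jsr_le _ _ _ _ (n.+1%:R * (1 + S))) => //.
- by rewrite mulr_ge0 // addr_ge0.
- exact: ltW.
move=> k A /trF /le_trans; apply; rewrite -mulrA ler_wpM2l //.
have [kK|Kk] := ltnP k K.+1.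
  rewrite -ler_pdivrMr ?exprn_gt0 // /S (bigD1 (Ordinal kK)) //= addrCA lerDl.
  by rewrite addr_ge0 // sumr_ge0.
case: k Kk => // k Kk; have := HK k.+1 (ltnW Kk).
rewrite /= powR_root_le // => /le_trans; apply.
rewrite -[leLHS]mul1r ler_pM ?exprn_ge0 //; first by rewrite lerDl.
by rewrite ler_pXn2r ?nnegrE ?lerDl ?(ltW y0) // ltW.
Unshelve. all: by end_near.
Qed.
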